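(* Let $\Phi$ be a fan in a finite-dimensional real vector space $V$. Then: (1) $\dim IH(\Phi)<\infty$; (2) $ih_j(\Phi)=0$ for $j<0$ or $j$ odd; (3) $ih_0(\Phi)=1$.
   Context: Fans. Let $V$ be a real vector space of dimension $n$. A fan $\Phi$ in $V$ is a finite collection of closed convex polyhedral cones with vertex at the origin such that any two cones in $\Phi$ intersect along a common face, and every face of a cone in $\Phi$ is in $\Phi$; the origin $o$ is the unique minimal cone of every fan. Write $\tau\le\sigma$ if $\tau$ is a face of $\sigma$. $\Phi$ is viewed as a topological space whose open subsets are the subfans. $[\sigma]$ is the open set of all faces of $\sigma$, $\partial\sigma$ the subfan of proper faces of $\sigma$. A sheaf $F$ on $\Phi$ is the same as a system of stalks $F_\sigma=\Gamma([\sigma];F)$ with compatible restriction maps $F_\sigma\to F_\tau$ for $\tau\le\sigma$. A sheaf is flabby if sections over any open subset extend to $\Phi$. Modules. $A=\mathrm{Sym}(V^* )$, graded with $V^*$ in degree 2. $\mathcal{A}_\Phi$ is the sheaf of graded algebras with $\mathcal{A}_{\Phi,\sigma}=\mathrm{Sym}(\mathrm{Span}(\sigma)^* )$ and restriction of functions as structure maps. All modules are graded and (locally) finitely generated. $\mathfrak{M}(\mathcal{A}_\Phi)$ is the category of flabby $\mathcal{A}_\Phi$-modules $\mathcal{M}$ that are locally free (each $\mathcal{M}_\sigma$ is a free graded $\mathcal{A}_{\Phi,\sigma}$-module), with morphisms of degree zero. $\overline{M}=M/A^+M$, with $A^+\subset A$ the ideal of elements of positive degree. $\mathcal{L}_\Phi$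 is the (unique up to isomorphism) minimal sheaf based at the origin: the object of $\mathfrak{M}(\mathcal{A}_\Phi)$ with $\mathcal{L}_{\Phi,o}=\mathbb{R}$ (in degree 0) such that for every cone $\tau\neq o$ the canonical map $\overline{\mathcal{L}_{\Phi,\tau}}\to\overline{\Gamma(\partial\tau;\mathcal{L}_\Phi)}$ is an isomorphism. The intersection cohomology of $\Phi$ is the graded vector space $IH(\Phi)=\overline{H^0(\Phi;\mathcal{L}_\Phi)}$, and $ih_j(\Phi)$ is the dimension of its degree $j$ component. *)

(* Defs.v *)
From HB Require Import structures.
From mathcomp Require Import all_boot all_order all_algebra.
From mathcomp Require Import finmap.
From mathcomp Require Import boolp classical_sets reals.
From mathcomp Require Import mpoly.

Set Implicit Arguments.
Unset Strict Implicit.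
Unset Printing Implicit Defensive.

Import Order.TTheory GRing.Theory Num.Theory.
Local Open Scope classical_set_scope.
Local Open Scope ring_scope.
Local Open Scope quotient_scope.

Section Fans.
Variables (R : realType) (V : vectType R).
Implicit Types (sigma tau : set V) (W U : {vspace V}).

Definition conical_hull (s : seq V) : set V :=
  [set x | exists c : 'I_(size s) -> R,
     (forall i, 0 <= c i) /\ x = \sum_(i < size s) c i *: s`_i].

Definition polyhedral_cone sigma := exists s : seq V, sigma = conical_hull s.

(* Faces are exposed faces; the form l = 0 gives sigma itself. *)
Definition face tau sigma :=
  exists l : {scalar V},
    (forall x, sigma x -> 0 <= l x) /\ tau = sigma `&` [set x | l x = 0].

(* Finitely generated cones are convex and closed.  The field [fan_vertex] says
   that the origin is a vertex (a zero-dimensional face) of every cone, so that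
   with [fan_neq0] and [fan_face] the origin is the least cone of the fan. *)
Record is_fan (Phi : {fset (set V)}) : Prop := IsFan {
  fan_neq0 : Phi != fset0;
  fan_cone : forall sigma, sigma \in Phi -> polyhedral_cone sigma;
  fan_vertex : forall sigma, sigma \in Phi -> face [set 0] sigma;
  fan_inter : forall sigma tau, sigma \in Phi -> tau \in Phi ->
    face (sigma `&` tau) sigma /\ face (sigma `&` tau) tau;
  fan_face : forall sigma tau, sigma \in Phi -> face tau sigma -> tau \in Phi
}.

Definition is_span sigma W :=
  (forall x, sigma x -> x \in W) /\
  (forall U, (forall x, sigma x -> x \in U) -> (W <= U)%VS).

Definition cspan sigma : {vspace V} := xget 0%VS [set W | is_span sigma W].

Lemma cspanP sigma : is_span sigma (cspan sigma).
Proof.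
rewrite /cspan; apply: (@xgetPex _ 0%VS [set W | is_span sigma W]).
pose P k := `[< exists W, (forall x, sigma x -> x \in W) /\ \dim W = k >].
have exP : exists k, P k.
  exists (\dim {:V}); apply/asboolP; exists fullv; split=> // x _; exact: memvf.
case: (ex_minnP exP) => k /asboolP[W [sW dW]] kmin.
exists W; split=> // U sU.
have sWU x : sigma x -> x \in (W :&: U)%VS.
  by move=> sx; rewrite memv_cap sW ?sU.
have le : (\dim W <= \dim (W :&: U)%VS)%N.
  by rewrite dW; apply: kmin; apply/asboolP; exists (W :&: U)%VS.
have : (W :&: U)%VS == W by rewrite eqEdim capvSl le.
by move/eqP <-; apply: capvSr.
Qed.

(* For a subspace [W], the algebra Sym(W^* ) is {mpoly R[\dim W]}, the i-th
   variable being the i-th coordinate form of the basis [vbasis W] of [W].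
   [restrE] shows that [restr] is restriction of polynomial functions.  A form
   of W^* has degree 2: [p] has degree 2k when [p \is k.-homog]. *)

Definition coordf W (i : 'I_(\dim W)) (x : V) : R := coord (vbasis W) i x.

(* For U <= W, each coordinate form of [W] goes to its restriction to [U]. *)
Definition restr W U : {mpoly R[\dim W]} -> {mpoly R[\dim U]} :=
  comp_mpoly
    [tuple \sum_(j < \dim U) coordf i (vbasis U)`_j *: 'X_j | i < \dim W].

Arguments restr : simpl never.

HB.instance Definition _ W U := GRing.RMorphism.on (@restr W U).
HB.instance Definition _ W U := GRing.Linear.on (@restr W U).

Definition evalf W (p : {mpoly R[\dim W]}) (x : V) : R :=
  p.@[fun i => coordf i x].

Lemma restrE W U p x : (U <= W)%VS -> x \in U ->
  evalf (restr U p) x = evalf (W := W) p x.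
Proof.
move=> UW xU; rewrite /evalf /restr comp_mpoly_meval.
apply: meval_eq => i; rewrite tnth_mktuple.
rewrite raddf_sum /= {2}(coord_vbasis xU) /coordf linear_sum.
apply: eq_bigr => j _.
by rewrite mevalZ mevalXU linearZ mulrC.
Qed.

Lemma restr_homog W U k (p : {mpoly R[\dim W]}) :
  p \is k.-homog -> restr U p \is k.-homog.
Proof.
move=> pk; rewrite /restr comp_mpolyEX big_seq; apply: rpred_sum => m mp.
apply: rpredZ; rewrite comp_mpolyX.
have <- : mdeg m = k := dhomog_mf pk mp.
rewrite mdegE.
elim/big_rec2: _ => [|i d q _ qd]; first exact: dhomog1.
apply: dhomogM qd; rewrite tnth_mktuple.
rewrite -{2}(mul1n (m i)); apply: dhomogMn; apply: rpred_sum => j _.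
by apply: rpredZ; rewrite dhomogX; apply/eqP; exact: mdeg1.
Qed.

Lemma restrX W U i : restr U ('X_i : {mpoly R[\dim W]}) =
  \sum_(j < \dim U) coordf i (vbasis U)`_j *: 'X_j.
Proof. by rewrite /restr comp_mpolyXU -tnth_nth tnth_mktuple. Qed.

Lemma restr_comp W W' U (p : {mpoly R[\dim W]}) :
  (U <= W')%VS -> restr U (restr W' p) = restr U p.
Proof.
move=> UW'.
have genX i : restr U (restr W' ('X_i : {mpoly R[\dim W]})) = restr U 'X_i.
  rewrite !restrX linear_sum /=.
  under eq_bigr => j _ do rewrite linearZ /= restrX.
  under eq_bigr => j _ do rewrite scaler_sumr.
  rewrite exchange_big /=; apply: eq_bigr => k _.
  under eq_bigr => j _ do rewrite scalerA.
  rewrite -scaler_suml; congr (_ *: _).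
  have kW' : (vbasis U)`_k \in W'.
    by apply: (subvP UW'); apply: vbasis_mem; rewrite mem_nth // size_tuple.
  rewrite /coordf {2}(coord_vbasis kW') linear_sum; apply: eq_bigr => j _.
  by rewrite linearZ mulrC.
elim/mpolyind: p => [|c m p _ _ IH]; first by rewrite !raddf0.
rewrite !linearP /= IH; congr (_ *: _ + _).
rewrite mpolyXE_id !rmorph_prod /=; apply: eq_bigr => i _.
by rewrite !rmorphXn /= genX.
Qed.

End Fans.

Section GradedModules.
Variables (R : realType) (n : nat).
Local Notation A := {mpoly R[n]}.

(* [H j] is the set of homogeneous elements of degree [j]; the module is the
   direct sum of the H j. *)
Record grading (M : lmodType A) (H : int -> set M) : Prop := Grading {
  grading0 : forall j, H j 0;
  gradingB : forall j x y, H j x -> H j y -> H j (x - y);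
  gradingZ : forall k j (p : A) x,
    p \is k.-homog -> H j x -> H (j + (k.*2)%:Z) (p *: x);
  grading_span : forall x, exists (s : seq int) (y : int -> M),
    [/\ uniq s, forall j, H j (y j) & x = \sum_(j <- s) y j];
  grading_free : forall (s : seq int) (y : int -> M),
    uniq s -> (forall j, H j (y j)) -> \sum_(j <- s) y j = 0 ->
    forall j, j \in s -> y j = 0
}.

Record gmod := GMod {
  gmod_sort :> lmodType A;
  homc : int -> set gmod_sort;
  homcP : grading homc
}.

Definition graded_free (M : gmod) :=
  exists (d : nat) (b : 'I_d -> M) (k : 'I_d -> int),
    (forall i, homc (k i) (b i)) /\
    forall x : M, exists! c : {ffun 'I_d -> A}, x = \sum_(i < d) c i *: b i.

Section Bar.
Variable M : lmodType A.

(* A polynomial lies in A^+ when its constant coefficient vanishes. *)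
Definition aug_set : set M :=
  [set x | exists (d : nat) (a : 'I_d -> A) (y : 'I_d -> M),
     (forall i, (a i)@_0%MM = 0) /\ x = \sum_(i < d) a i *: y i].

Definition aug : {pred M} := fun x => `[< aug_set x >].

Lemma augP x : reflect (aug_set x) (x \in aug).
Proof. exact: asboolP. Qed.

Lemma aug_zmod_closed : zmod_closed aug.
Proof.
split.
  apply/augP; exists 0%N, (fun=> 0), (fun=> 0); split=> [i|]; first by case: i.
  by rewrite big_ord0.
move=> x y /augP[d [a [u [a0 ->]]]] /augP[e [b [v [b0 ->]]]]; apply/augP.
exists (d + e)%N,
  (fun i => match split i with inl j => a j | inr j => - b j end),
  (fun i => match split i with inl j => u j | inr j => v j end); split=> [i|].
  by case: (split i) => j //; rewrite mcoeffN b0 oppr0.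
rewrite big_split_ord /= -sumrN; congr (_ + _); apply: eq_bigr => i _.
  by rewrite (unsplitK (inl i)).
by rewrite (unsplitK (inr i)) scaleNr.
Qed.

HB.instance Definition _ := GRing.isZmodClosed.Build M aug aug_zmod_closed.

Lemma augZ (p : A) x : x \in aug -> p *: x \in aug.
Proof.
case/augP => d [a [y [a0 ->]]]; apply/augP.
exists d, (fun i => p * a i), y; split=> [i|].
  by rewrite rmorphM /= a0 mulr0.
by rewrite scaler_sumr; apply: eq_bigr => i _; rewrite scalerA.
Qed.

Definition bar : Type := Quotient.quot aug.
HB.instance Definition _ := GRing.Zmodule.on bar.

Definition to_bar (x : M) : bar := \pi_(Quotient.quot aug) x.
Definition of_bar (x : bar) : M := repr (x : Quotient.quot aug).

Lemma of_barK : cancel of_bar to_bar.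
Proof. by move=> x; rewrite /to_bar /of_bar reprK. Qed.

Lemma to_barP x y : to_bar x = to_bar y <-> x - y \in aug.
Proof. by rewrite Quotient.idealrBE; split=> [/eqP|/eqP]. Qed.

Lemma to_bar_is_zmod_morphism : zmod_morphism to_bar.
Proof. by move=> x y; rewrite /to_bar raddfB. Qed.

HB.instance Definition _ :=
  GRing.isZmodMorphism.Build M bar to_bar to_bar_is_zmod_morphism.

Definition bar_scale (c : R) (x : bar) : bar := to_bar (c%:MP *: of_bar x).

Lemma to_barZ c x : to_bar (c%:MP *: x) = bar_scale c (to_bar x).
Proof.
by apply/to_barP; rewrite -scalerBr; apply/augZ/to_barP; rewrite of_barK.
Qed.

Lemma bar_scaleA a b x : bar_scale a (bar_scale b x) = bar_scale (a * b) x.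
Proof. by rewrite -[x]of_barK -!to_barZ scalerA mpolyCM. Qed.

Lemma bar_scale1 : left_id 1 bar_scale.
Proof. by move=> x; rewrite -[x]of_barK -!to_barZ scale1r. Qed.

Lemma bar_scaleDr : right_distributive bar_scale +%R.
Proof.
move=> c x y; rewrite -[x]of_barK -[y]of_barK -raddfD -!to_barZ.
by rewrite scalerDr raddfD.
Qed.

Lemma bar_scaleDl x : {morph bar_scale^~ x : a b / a + b}.
Proof.
by move=> a b; rewrite -[x]of_barK -!to_barZ -raddfD -scalerDl mpolyCD.
Qed.

HB.instance Definition _ := GRing.Zmodule_isLmodule.Build R bar
  bar_scaleA bar_scale1 bar_scaleDr bar_scaleDl.
End Bar.

Definition bar_map (M N : lmodType A) (f : {linear M -> N}) (x : bar M) :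
  bar N := to_bar (f (of_bar x)).

Lemma bar_mapE (M N : lmodType A) (f : {linear M -> N}) x :
  bar_map f (to_bar x) = to_bar (f x).
Proof.
apply/to_barP; rewrite -linearB.
have /to_barP/augP[d [a [y [a0 ->]]]] := of_barK (to_bar x).
rewrite linear_sum; apply/augP; exists d, a, (f \o y); split=> //.
by apply: eq_bigr => i _; rewrite linearZ.
Qed.

Definition bar_homc (M : gmod) (j : int) : set (bar M) :=
  [set to_bar x | x in @homc M j].

End GradedModules.

Definition has_dim (R : realType) (E : lmodType R) (W : set E) (d : nat) :=
  exists b : 'I_d -> E,
    (forall i, W (b i)) /\
    forall x, W x -> exists! c : {ffun 'I_d -> R}, x = \sum_(i < d) c i *: b i.

Definition prod_lmod (A : nzRingType) (I : Type) (T : I -> lmodType A) : Type :=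
  forall i, T i.

Section ProdLmod.
Variables (A : nzRingType) (I : Type) (T : I -> lmodType A).
Local Notation P := (prod_lmod T).
Implicit Types x y z : P.

HB.instance Definition _ := gen_eqMixin P.
HB.instance Definition _ := gen_choiceMixin P.

Lemma prodP x y : (forall i, x i = y i) -> x = y.
Proof. exact: functional_extensionality_dep. Qed.

Definition prod_zero : P := fun=> 0.
Definition prod_opp x : P := fun i => - x i.
Definition prod_add x y : P := fun i => x i + y i.
Definition prod_scale (a : A) x : P := fun i => a *: x i.

Lemma prod_addA : associative prod_add.
Proof. by move=> x y z; apply: prodP => i; apply: addrA. Qed.
Lemma prod_addC : commutative prod_add.
Proof. by move=> x y; apply: prodP => i; apply: addrC. Qed.
Lemma prod_add0 : left_id prod_zero prod_add.
Proof. by move=> x; apply: prodP => i; apply: add0r. Qed.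
Lemma prod_addN : left_inverse prod_zero prod_opp prod_add.
Proof. by move=> x; apply: prodP => i; apply: addNr. Qed.

HB.instance Definition _ :=
  GRing.isZmodule.Build P prod_addA prod_addC prod_add0 prod_addN.

Lemma prod_scaleA a b x : prod_scale a (prod_scale b x) = prod_scale (a * b) x.
Proof. by apply: prodP => i; apply: scalerA. Qed.
Lemma prod_scale1 : left_id 1 prod_scale.
Proof. by move=> x; apply: prodP => i; apply: scale1r. Qed.
Lemma prod_scaleDr : right_distributive prod_scale +%R.
Proof. by move=> a x y; apply: prodP => i; apply: scalerDr. Qed.
Lemma prod_scaleDl x : {morph prod_scale^~ x : a b / a + b}.
Proof. by move=> a b; apply: prodP => i; apply: scalerDl. Qed.

HB.instance Definition _ := GRing.Zmodule_isLmodule.Build A P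
  prod_scaleA prod_scale1 prod_scaleDr prod_scaleDl.

Lemma prod_sumE (J : Type) (s : seq J) (F : J -> P) i :
  (\sum_(j <- s) F j) i = \sum_(j <- s) F j i.
Proof. by elim/big_rec2: _ => // j u v _ <-. Qed.
End ProdLmod.

Definition res_scal (A B : nzRingType) (f : {rmorphism A -> B})
  (M : lmodType B) : Type := M.

Section ResScal.
Variables (A B : nzRingType) (f : {rmorphism A -> B}) (M : lmodType B).
Local Notation N := (res_scal f M).

HB.instance Definition _ := GRing.Zmodule.on N.

Definition res_scale (a : A) (x : N) : N := f a *: (x : M).

Lemma res_scaleA a b x : res_scale a (res_scale b x) = res_scale (a * b) x.
Proof. by rewrite /res_scale scalerA rmorphM. Qed.
Lemma res_scale1 : left_id 1 res_scale.
Proof. by move=> x; rewrite /res_scale rmorph1 scale1r. Qed.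
Lemma res_scaleDr : right_distributive res_scale +%R.
Proof. by move=> a x y; apply: scalerDr. Qed.
Lemma res_scaleDl x : {morph res_scale^~ x : a b / a + b}.
Proof. by move=> a b; rewrite /res_scale rmorphD scalerDl. Qed.

HB.instance Definition _ := GRing.Zmodule_isLmodule.Build A N
  res_scaleA res_scale1 res_scaleDr res_scaleDl.
End ResScal.

Section Sheaves.
Variables (R : realType) (V : vectType R) (Phi : {fset (set V)}).
Implicit Types (sigma tau upsilon : Phi) (U : {set Phi}).

Definition fle tau sigma : bool := `[< face (val tau) (val sigma) >].

Definition span_cone sigma : {vspace V} := cspan (val sigma).

Local Notation A := {mpoly R[\dim (fullv : {vspace V})]}.

Lemma span_coneS sigma tau :
  fle tau sigma -> (span_cone tau <= span_cone sigma)%VS.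
Proof.
case/asboolP => l [_ tauE]; have [_ least] := cspanP (val tau).
apply: least => x; rewrite tauE => -[sx _].
by have [incl _] := cspanP (val sigma); apply: incl.
Qed.

(* A graded module over the sheaf of algebras sigma |-> Sym(Span(sigma)^* ),
   given by its stalks and restriction maps.  Only the maps [res sigma tau] with
   tau <= sigma are part of the structure; the others are arbitrary. *)
Record sheaf := Sheaf {
  stalk :> forall sigma, gmod R (\dim (span_cone sigma));
  res : forall sigma tau, {additive stalk sigma -> stalk tau};
  resZ : forall sigma tau (p : {mpoly R[\dim (span_cone sigma)]})
      (x : stalk sigma), fle tau sigma ->
    res sigma tau (p *: x) = restr (span_cone tau) p *: res sigma tau x;
  res_homc : forall sigma tau j (x : stalk sigma), fle tau sigma ->
    homc j x -> homc j (res sigma tau x);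
  res_id : forall sigma (x : stalk sigma), res sigma sigma x = x;
  res_comp : forall sigma tau upsilon (x : stalk sigma),
    fle tau sigma -> fle upsilon tau ->
    res tau upsilon (res sigma tau x) = res sigma upsilon x
}.

Variable L : sheaf.

Definition stalkA sigma : lmodType A :=
  res_scal (@restr R V fullv (span_cone sigma)) (L sigma).

Definition is_open U :=
  forall sigma tau, sigma \in U -> fle tau sigma -> tau \in U.

(* Sections over [U] are the compatible families of elements of the stalks at
   the cones of [U], i.e. the inverse limit of these stalks. *)
Section Sections.
Variable U : {set Phi}.
Local Notation family :=
  (prod_lmod (fun sigma : {x | x \in U} => stalkA (val sigma))).

Definition compatible : {pred family} := fun s =>
  `[< forall sigma tau : {x | x \in U}, fle (val tau) (val sigma) ->
        res L (val sigma) (val tau) (s sigma) = s tau >].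

Lemma compatible_submod_closed : submod_closed compatible.
Proof.
split=> [|a s t /asboolP cs /asboolP ct]; apply/asboolP => sigma tau le.
  by rewrite raddf0.
have famE (i : {x | x \in U}) :
  (a *: s + t) i = restr _ a *: (s i : L (val i)) + (t i : L (val i)) by [].
rewrite !famE raddfD resZ // (cs _ _ le) (ct _ _ le) restr_comp //.
exact: span_coneS.
Qed.

HB.instance Definition _ :=
  GRing.isSubmodClosed.Build A family compatible compatible_submod_closed.

Record Gamma : Type := Section_ {
  sec : family;
  _ : sec \in compatible
}.

HB.instance Definition _ := [isSub for sec].
HB.instance Definition _ := [Choice of Gamma by <:].
HB.instance Definition _ := [SubChoice_isSubLmodule of Gamma by <:].

Definition Gamma_homc (j : int) : set Gamma :=
  [set s : Gamma | forall i : {x | x \in U}, homc j (sec s i : L (val i))].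

Lemma sec_compatible (s : Gamma) (i k : {x | x \in U}) :
  fle (val k) (val i) -> res L (val i) (val k) (sec s i) = sec s k.
Proof. by case: s => s /= /asboolP cs; apply: cs. Qed.

Lemma sec_inj : injective sec.
Proof. exact: val_inj. Qed.

Lemma sec_sumE (J : Type) (r : seq J) (F : J -> Gamma) i :
  sec (\sum_(j <- r) F j) i = \sum_(j <- r) (sec (F j) i : L (val i)).
Proof.
have sec0 : sec 0 = 0 by exact: (raddf0 (\val : {additive Gamma -> family})).
have secD a b : sec (a + b) = sec a + sec b.
  exact: (raddfD (\val : {additive Gamma -> family})).
by elim/big_rec2: _ => [|j u v _ <-]; rewrite ?sec0 ?secD.
Qed.

Lemma Gamma_grading : grading Gamma_homc.
Proof.
split.
- by move=> j i; apply: (grading0 (homcP (L (val i)))).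
- by move=> j x y hx hy i; apply: (gradingB (homcP (L (val i)))).
- move=> k j p x pk hx i.
  by apply: (gradingZ (homcP (L (val i)))); [apply: restr_homog|apply: hx].
- move=> x.
  have dec i : exists ry : seq int * (int -> L (val i)),
      [/\ uniq ry.1, forall j, homc j (ry.2 j)
        & (sec x i : L (val i)) = \sum_(j <- ry.1) ry.2 j].
    have [r [y [ur hy xy]]] := grading_span (homcP (L (val i))) (sec x i).
    by exists (r, y).
  pose ry i := proj1_sig (cid (dec i)).
  have ryP i : [/\ uniq (ry i).1, forall j, homc j ((ry i).2 j)
      & (sec x i : L (val i)) = \sum_(j <- (ry i).1) (ry i).2 j].
    exact: proj2_sig (cid (dec i)).
  pose r := undup (flatten [seq (ry i).1 | i : {x | x \in U}]).
  have rsub i j : j \in (ry i).1 -> j \in r.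
    move=> jr; rewrite mem_undup; apply/flattenP; exists (ry i).1 => //.
    by apply/mapP; exists i; rewrite ?mem_enum.
  pose z j : family := fun i => if j \in (ry i).1 then (ry i).2 j else 0.
  have zh j i : homc j (z j i : L (val i)).
    rewrite /z; case: ifP => _; first by have [_ hy _] := ryP i; apply: hy.
    exact: (grading0 (homcP (L (val i)))).
  have zsum i : \sum_(j <- r) (z j i : L (val i)) = sec x i.
    have [u _ ->] := ryP i; rewrite /z -big_mkcond /= -big_filter.
    apply: perm_big; apply: uniq_perm => //.
      by rewrite filter_uniq // undup_uniq.
    by move=> j; rewrite mem_filter andb_idr //; apply: rsub.
  have zc j : z j \in compatible.
    apply/asboolP => i k le.
    case jr: (j \in r); last first.
      have out l : z j l = 0 by rewrite /z; case: ifP => // /rsub; rewrite jr.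
      by rewrite !out raddf0.
    apply/eqP; rewrite -subr_eq0; apply/eqP.
    have ur : uniq r by apply: undup_uniq.
    pose w j' : L (val k) := res L (val i) (val k) (z j' i) - z j' k.
    apply: (grading_free (homcP (L (val k))) (y := w) ur) => // [j'|].
      apply: (gradingB (homcP (L (val k)))); last exact: zh.
      by apply: res_homc => //; apply: zh.
    by rewrite sumrB -raddf_sum !zsum sec_compatible // subrr.
  exists r, (fun j => Section_ (zc j)); split=> //.
    by apply: undup_uniq.
  apply: sec_inj; apply: prodP => i.
  by rewrite sec_sumE -zsum.
move=> r y ur hy y0 j jr; apply: sec_inj; apply: prodP => i.
apply: (grading_free (homcP (L (val i)))
  (y := fun j' => sec (y j') i) ur) => //.
  by move=> j'; apply: hy.
by rewrite -sec_sumE y0.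
Qed.

Definition sections : gmod R (\dim (fullv : {vspace V})) := GMod Gamma_grading.
End Sections.

Definition flabby := forall U, is_open U -> forall s : Gamma U,
  exists t : Gamma [set: Phi],
    forall (sigma : Phi) (sigmaU : sigma \in U),
      sec s (exist _ sigma sigmaU) =
      sec t (exist _ sigma (finset.in_setT sigma)).

Definition locally_free := forall sigma, graded_free (L sigma).

Definition bdry tau : {set Phi} := [set sigma | fle sigma tau & sigma != tau].

Section BoundaryMap.
Variable tau : Phi.

Definition germ_family (x : stalkA tau) :
    prod_lmod (fun sigma : {y | y \in bdry tau} => stalkA (val sigma)) :=
  fun i => res L tau (val i) x.

Lemma bdryW (i : {y | y \in bdry tau}) : fle (val i) tau.
Proof. by case: i => i /=; rewrite inE => /andP[]. Qed.

Lemma germ_family_compatible x : germ_family x \in @compatible (bdry tau).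
Proof. by apply/asboolP => i k le; apply: res_comp => //; apply: bdryW. Qed.

Definition germ (x : stalkA tau) : Gamma (bdry tau) :=
  Section_ (germ_family_compatible x).

Lemma germ_is_linear : linear germ.
Proof.
move=> a x y; apply: sec_inj; apply: prodP => i.
have le := bdryW i.
rewrite -[LHS]/(res L tau (val i) (restr _ a *: (x : L tau) + (y : L tau))).
rewrite raddfD resZ // restr_comp //; exact: span_coneS.
Qed.

HB.instance Definition _ := GRing.isLinear.Build A (stalkA tau)
  (Gamma (bdry tau)) _ germ germ_is_linear.
End BoundaryMap.

(* Both quotients are taken with respect to the A-module structures, and [germ]
   has degree zero, so bijectivity makes [bar_map (germ tau)] an isomorphism of
   graded vector spaces. *)
Record minimal_sheaf : Prop := MinimalSheaf {
  minimal_flabby : flabby;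
  minimal_free : locally_free;
  minimal_origin : forall o : Phi, val o = [set 0] ->
    exists e : L o, homc 0 e /\
      forall x : L o, exists! c : R, x = c%:MP *: e;
  minimal_bdry : forall tau, val tau <> [set 0] ->
    bijective (bar_map (@germ tau))
}.

(* The minimal sheaf is unique up to isomorphism; IH is defined for any sheaf [L]
   and used when [L] is minimal. *)
Definition IH : lmodType R := bar (sections [set: Phi]).

Definition IH_deg (j : int) : set IH :=
  @bar_homc R _ (sections [set: Phi]) j.

(* [ih j d] is the relation ih_j = d. *)
Definition ih (j : int) (d : nat) := has_dim (IH_deg j) d.

End Sheaves.

(* Main.v *)
(* Sections of L embed in a finite product of stalks, which are finitely
   generated over the Noetherian ring A; hence Gamma(Phi; L) is finitely
   generated, and (1) follows.

   For (2), let j be negative or odd. By induction on the dimension of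
   Span(sigma), the sections of L over the boundary of sigma vanish in degree j,
   so by minimality the degree j part of L_sigma lies in A^+ L_sigma. It is
   therefore generated by elements of degrees j - 2k with k > 0, which are
   negative or odd again. As the degrees of L_sigma are bounded below, it is 0.

   For (3), negative degrees vanish, so A^+ M has no degree 0 part when M is
   L_sigma or the module of sections over the boundary of sigma, and minimality
   makes these two isomorphic in degree 0. By induction the restriction from
   L_sigma to L_o is an isomorphism in degree 0 for every sigma, so the degree 0
   sections over Phi correspond to L_o, a line. *)
Require Import Defs.
From HB Require Import structures.
From mathcomp Require Import all_boot all_order all_algebra.
From mathcomp Require Import finmap.
From mathcomp Require Import boolp classical_sets reals.
From mathcomp Require Import mpoly.
From mathcomp Require Import zify.

Set Implicit Arguments.
Unset Strict Implicit.
Unset Printing Implicit Defensive.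

Import Order.TTheory GRing.Theory Num.Theory.
Local Open Scope classical_set_scope.
Local Open Scope ring_scope.

(** * Finitely generated submodules and Noetherian modules *)

Section FinitelyGenerated.
Variable A : nzRingType.

Definition submodule (M : lmodType A) (P : set M) :=
  P 0 /\ forall (a : A) x y, P x -> P y -> P (a *: x + y).

(** Generation is tested on submodules containing [s], so that it can be used like an induction
    principle without writing linear combinations. *)
Definition fin_gen (M : lmodType A) (P : set M) :=
  exists s : seq M, (forall y, y \in s -> P y) /\
    forall Q : set M, submodule Q -> (forall y, y \in s -> Q y) -> P `<=` Q.

Definition noetherian (M : lmodType A) :=
  forall P : set M, submodule P -> fin_gen P.

Lemma submoduleB (M : lmodType A) (P : set M) x y :
  submodule P -> P x -> P y -> P (x - y).
Proof.
by move=> [_ Plin] Px Py; rewrite addrC -scaleN1r; apply: Plin.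
Qed.

Lemma submodule_lift (M N : lmodType A) (f : {linear M -> N}) (P : set M)
    (t : seq N) :
  (forall y, y \in t -> exists2 x, P x & f x = y) ->
  exists s : seq M, (forall x, x \in s -> P x) /\ [seq f x | x <- s] = t.
Proof.
elim: t => [|y t IH] Pt; first by exists [::].
have [|s [Ps fs]] := IH; first by move=> z zt; apply: Pt; rewrite inE zt orbT.
have [x Px fx] := Pt y (mem_head _ _).
exists (x :: s); rewrite /= fx fs; split=> // z.
by rewrite inE => /predU1P[->|/Ps].
Qed.

(** Induction on [r]: lifts of generators of the image of [P] under [f i], together with generators
    of the kernel of [f i] on [P], generate [P]. *)
Lemma fin_gen_jointly_injective (M : lmodType A) (I : eqType)
    (N : I -> lmodType A) (f : forall i, {linear M -> N i}) (r : seq I) :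
  (forall i, noetherian (N i)) ->
  forall P : set M, submodule P ->
  (forall x, P x -> (forall i, i \in r -> f i x = 0) -> x = 0) -> fin_gen P.
Proof.
move=> nN; elim: r => [|i r IH] P sP Pker.
  exists [::]; split=> // Q [Q0 _] _ x Px; suff -> : x = 0 by [].
  exact: Pker.
have [P0 Plin] := sP.
have [|t [Pt tgen]] := nN i [set y | exists2 x, P x & f i x = y].
  split; first by exists 0; rewrite ?raddf0.
  move=> a _ _ [x Px <-] [y Py <-]; exists (a *: x + y).
    exact: Plin.
  by rewrite linearP.
have [s [Ps fs]] := submodule_lift Pt.
have [||u [Pu ugen]] := IH [set x | P x /\ f i x = 0].
- split; first by rewrite /= raddf0.
  move=> a x y /= [Px x0] [Py y0]; rewrite linearP x0 y0 scaler0 addr0.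
  by split=> //; apply: Plin.
- move=> x [Px x0] xr; apply: Pker => // j.
  by rewrite inE => /predU1P[->|/xr].
exists (s ++ u); split=> [y|Q sQ Qsu x Px].
  by rewrite mem_cat => /orP[/Ps|/Pu[]].
have [Q0 Qlin] := sQ.
(* The lift is taken in [P] as well as in [Q], since [ugen] applies to [x - z] only if it lies in
   [P]. *)
have [z [Qz Pz] fz] : [set y | exists2 z, Q z /\ P z & f i z = y] (f i x).
  apply: tgen => [|y|].
  - split; first by exists 0; rewrite ?raddf0.
    move=> a _ _ [z [Qz Pz] <-] [w [Qw Pw] <-]; exists (a *: z + w).
      by split; [apply: Qlin|apply: Plin].
    by rewrite linearP.
  - rewrite -fs => /mapP[z zs ->]; exists z => //.
    by split; [apply: Qsu; rewrite mem_cat zs|apply: Ps].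
  - by exists x.
have -> : x = 1 *: (x - z) + z by rewrite scale1r subrK.
apply: Qlin => //; apply: (ugen Q) => // [y yu|].
  by apply: Qsu; rewrite mem_cat yu orbT.
by split; [apply: submoduleB|rewrite raddfB /= fz subrr].
Qed.

End FinitelyGenerated.

(** As [f] is onto, the submodules over [A] and over [B] are the same sets. *)
Lemma noetherian_res_scal (A B : nzRingType) (f : {rmorphism A -> B})
    (M : lmodType B) :
  (forall b, exists a, f a = b) -> noetherian M -> noetherian (res_scal f M).
Proof.
move=> fsurj nM P [P0 Plin].
have [|s [Ps sgen]] := nM P.
  by split=> // b x y Px Py; have [a <-] := fsurj b; apply: (Plin a).
exists s; split=> // Q [Q0 Qlin] Qs; apply: sgen => //.
by split=> // b x y Qx Qy; have [a <-] := fsurj b; apply: (Qlin a).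
Qed.

(** * Dickson's lemma and Hilbert's basis theorem *)

(** Each [phi k] is an index where [u] attains its minimum over a tail; the tails shrink, so these
    minima do not decrease. *)
Lemma nondecreasing_subseq (u : nat -> nat) :
  exists phi : nat -> nat, {homo phi : i j / (i < j)%N} /\
    {homo (u \o phi) : i j / (i <= j)%N}.
Proof.
have next N : exists m, (N <= m)%N /\ forall k, (N <= k)%N -> (u m <= u k)%N.
  have ex : exists v, `[< exists2 m, (N <= m)%N & u m = v >].
    by exists (u N); apply/asboolP; exists N.
  case: (ex_minnP ex) => v /asboolP[m Nm <-] vmin.
  by exists m; split=> // k Nk; apply: vmin; apply/asboolP; exists k.
have [g gP] := choice next.
pose phi := fix phi k := if k is k'.+1 then g (phi k').+1 else g 0%N.
exists phi; split.
  by apply: homo_ltn => [|k]; [exact: ltn_trans|have [] := gP (phi k).+1].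
apply: homo_leq => [//||k]; first by move=> ? ? ?; apply: leq_trans.
have [kS _] := gP (phi k).+1.
case: k kS => [|k] kS; [apply: (gP 0%N).2 => //|apply: (gP (phi k).+1).2].
by apply: leq_trans (ltnW kS); have [] := gP (phi k).+1.
Qed.

(* Dickson's lemma. *)
Lemma nondecreasing_subseq_family (I : eqType) (u : I -> nat -> nat)
    (r : seq I) :
  exists phi : nat -> nat, {homo phi : i j / (i < j)%N} /\
    forall l, l \in r -> {homo (u l \o phi) : i j / (i <= j)%N}.
Proof.
elim: r => [|l r [phi [phi_lt phi_r]]]; first by exists id; split.
have [psi [psi_lt psi_l]] := nondecreasing_subseq (u l \o phi).
exists (phi \o psi); split=> [i j ij|k]; first exact/phi_lt/psi_lt.
rewrite inE => /predU1P[->//|/phi_r kr] i j ij; apply: kr.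
rewrite leq_eqVlt in ij; case/predU1P: ij => [->//|/psi_lt]; exact: ltnW.
Qed.

(* Otherwise there would be an infinite sequence whose k-th term has the least
   leading monomial among the elements of the ideal that do not lie in the ideal
   generated by the previous terms. By Dickson's lemma the leading monomial of
   some term divides that of a later one, which can then be reduced. *)
Lemma noetherian_mpoly (K : fieldType) (n : nat) :
  noetherian ({mpoly K[n]}^o : lmodType {mpoly K[n]}).
Proof.
move=> P sP; apply: contrapT => nfg.
pose gen (s : seq {mpoly K[n]}) x := forall Q : set {mpoly K[n]},
  @submodule _ {mpoly K[n]}^o Q -> (forall y, y \in s -> Q y) -> Q x.
(* A list not contained in [P] gets the dummy value [0], so that [choice] yields a function on all
   lists. *)
have next (s : seq {mpoly K[n]}) : exists x, (forall y, y \in s -> P y) ->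
  [/\ P x, ~ gen s x &
    forall y, P y -> (mlead y < mlead x)%O -> gen s y].
  have [sPs|] := pselect (forall y, y \in s -> P y); last by exists 0.
  have ex : exists y, P y /\ ~ gen s y.
    apply: contrapT => /forallNP nex; apply: nfg; exists s.
    split=> // Q sQ Qs x Px.
    by have /not_andP[//|/contrapT] := nex x; apply.
  have [y [Py ngy]] := ex; elim/(well_founded_ind (@ltom_wf n)): {y}(mlead y)
    {-2}y (erefl (mlead y)) Py ngy => m IH y ym Py ngy.
  have [[z [Pz zy ngz]]|nz] :=
      pselect (exists z, [/\ P z, (mlead z < mlead y)%O & ~ gen s z]).
    by apply: (IH (mlead z) _ z) => //; rewrite -ym.
  exists y => _; split=> // z Pz zy; apply: contrapT => ngz.
  by apply: nz; exists z.
have [g gP] := choice next.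
pose S := fix S k := if k is k'.+1 then g (S k') :: S k' else [::].
have SP k : forall y, y \in S k -> P y.
  elim: k => [//|k IH] y /=; rewrite inE => /predU1P[->|/IH//].
  by have [] := gP _ IH.
have Smem i j : (i < j)%N -> g (S i) \in S j.
  elim: j => [//|j IH]; rewrite ltnS leq_eqVlt => /predU1P[->|/IH gS] /=.
    exact: mem_head.
  by rewrite inE gS orbT.
have [phi [phi_lt phi_le]] := nondecreasing_subseq_family
  (fun (l : 'I_n) k => mlead (g (S k)) l) (enum 'I_n).
set i := phi 0%N; set j := phi 1%N.
have ij : (i < j)%N by apply: phi_lt.
have le : (mlead (g (S i)) <= mlead (g (S j)))%MM.
  by apply/mnm_lepP => l; apply: (phi_le l) => //; rewrite mem_enum.
have [Pi ngi _] := gP _ (SP i); have [Pj ngj minj] := gP _ (SP j).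
have nz k : g (S k) != 0.
  have [_ ng _] := gP _ (SP k); apply/eqP => E; apply: ng.
  by move=> Q [Q0 _] _; rewrite E.
set p := g (S i) in le Pi ngi; set q := g (S j) in le Pj ngj minj.
(* [h * p] has the leading term of [q], so [q - h * p] is zero or has a smaller leading monomial; by
   the choice of [q] it is generated by [S j]. *)
pose h : {mpoly K[n]} := (mleadc q / mleadc p) *: 'X_[mlead q - mlead p].
have hne : mleadc q / mleadc p != 0.
  by rewrite mulf_neq0 ?invr_eq0 ?mleadc_eq0 ?nz.
have hX : h != 0.
  rewrite scaler_eq0 (negPf hne) /= -mleadc_eq0 mleadXm mcoeffX eqxx.
  exact: oner_neq0.
have hlead : mlead (h * p) = mlead q.
  by rewrite mleadM ?nz // mleadZ // mleadXm submK.
have hc : (h * p)@_(mlead q) = mleadc q.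
  rewrite -{1}(submK le) -{1}(mleadXm K (mlead q - mlead p)).
  rewrite -(mleadZ _ hne) mleadcM mleadcZE mleadXm mcoeffX eqxx mulr1.
  by rewrite divfK // mleadc_eq0 nz.
have Pr : P (q - h * p).
  by apply: (submoduleB sP) => //; have := sP.2 h p 0 Pi sP.1; rewrite addr0.
have genr : gen (S j) (q - h * p).
  have [->|r0] := eqVneq (q - h * p) 0; first by move=> Q [].
  apply: minj => //; rewrite lt_neqAle; apply/andP; split.
    apply: contraNneq r0 => E; rewrite -mleadc_eq0 E mcoeffB hc subrr //.
  by have := mleadB_le q (h * p); rewrite hlead joinxx.
apply: ngj => Q sQ QS; have [Q0 Qlin] := sQ.
have -> : q = h *: (p : {mpoly K[n]}^o) + (q - h * p) by rewrite addrC subrK.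
by apply: Qlin; [apply: QS; apply: Smem|apply: genr].
Qed.

(** * Finite dimension of [bar M] *)

(** A spanning family of least size is a basis: two expansions differing at [i0] would express
    [b i0] through the other members. *)
Lemma has_dim_of_span (K : realType) (E : lmodType K) (d : nat)
    (b : 'I_d -> E) :
  (forall x, exists c : 'I_d -> K, x = \sum_(i < d) c i *: b i) ->
  exists e, has_dim [set: E] e.
Proof.
pose spans d (b : 'I_d -> E) :=
  forall x, exists c : 'I_d -> K, x = \sum_(i < d) c i *: b i.
rewrite -/(spans d b) => spb.
have ex : exists d, `[< exists b, @spans d b >].
  by exists d; apply/asboolP; exists b.
case: (ex_minnP ex) => {spb b ex}e /asboolP[b spb] emin.
exists e, b; split=> // x _; have [c xc] := spb x.
exists [ffun i => c i]; split; first by under eq_bigr do rewrite ffunE.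
move=> c' xc'; apply/ffunP => i0; rewrite ffunE; apply: contrapT => /eqP ne.
case: e => [|e] in b spb emin c xc c' xc' i0 ne *; first by case: i0 ne.
suff : (e.+1 <= e)%N by rewrite ltnn.
apply: emin; apply/asboolP; exists (b \o lift i0).
have [a a0] : exists a : 'I_e -> K, b i0 = \sum_(i < e) a i *: b (lift i0 i).
  exists (fun i => (c i0 - c' i0)^-1 * (c' (lift i0 i) - c (lift i0 i))).
  have nz : c i0 - c' i0 != 0 by rewrite subr_eq0.
  apply: (scalerI nz); rewrite scaler_sumr.
  have /eqP := etrans (esym xc) xc'; rewrite !(bigD1_ord i0) //=.
  rewrite -subr_eq0 opprD addrACA -scalerBl -sumrB addr_eq0 => /eqP ->.
  rewrite -sumrN; apply: eq_bigr => i _.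
  by rewrite scalerA mulrA divff // mul1r -scalerBl -scaleNr opprB.
move=> y; have [f ->] := spb y.
exists (fun i => f i0 * a i + f (lift i0 i)); rewrite (bigD1_ord i0) //= {1}a0.
rewrite scaler_sumr -big_split /=; apply: eq_bigr => i _.
by rewrite scalerDl scalerA.
Qed.

(** Modulo [A^+ M] a polynomial acts through its constant coefficient, so the classes of module
    generators span over [K]. *)
Lemma has_dim_bar (K : realType) (n : nat) (M : lmodType {mpoly K[n]}) :
  fin_gen [set: M] -> exists d, has_dim [set: bar M] d.
Proof.
case=> s [_ sgen].
apply: (@has_dim_of_span _ _ (size s) (fun i => to_bar s`_i)) => x.
rewrite -[x]of_barK; move: (of_bar x) => {}x.
pose Q := [set y : M | exists c : 'I_(size s) -> K,
  to_bar y = \sum_(i < size s) c i *: to_bar s`_i].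
apply: (sgen Q) => // [|y ys].
  split.
    by exists (fun=> 0); rewrite raddf0 big1 // => i _; rewrite scale0r.
  move=> a y z [c yc] [d zd]; exists (fun i => a@_0%MM * c i + d i).
  under eq_bigr do rewrite scalerDl -scalerA.
  rewrite big_split -scaler_sumr /= -yc -zd raddfD; congr (_ + _).
  apply: etrans (to_barZ _ _); apply/to_barP; rewrite -scalerBl; apply/augP.
  exists 1%N, (fun=> a - (a@_0%MM)%:MP), (fun=> y); rewrite big_ord1; split=> //.
  by move=> _; rewrite mcoeffB mcoeffC eqxx mulr1 subrr.
have ks : (index y s < size s)%N by rewrite index_mem.
exists (fun i => (i == Ordinal ks)%:R).
rewrite (bigD1 (Ordinal ks)) //= eqxx scale1r big1 ?addr0 ?nth_index //.
by move=> i /negPf ->; rewrite scale0r.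
Qed.

Lemma has_dim0 (K : realType) (E : lmodType K) (W : set E) :
  W `<=` [set 0] -> has_dim W 0.
Proof.
move=> W0; exists (fun=> 0); split=> [[]//|x /W0 ->].
exists [ffun=> 0]; split; first by rewrite big_ord0.
by move=> c _; apply/ffunP => -[].
Qed.

(** * Homogeneous components and [A^+ M] *)

Section Gradings.
Variables (K : realType) (n : nat) (M : lmodType {mpoly K[n]}).
Variables (H : int -> set M) (gH : grading H).

Lemma gradingD j x y : H j x -> H j y -> H j (x + y).
Proof.
move=> Hx Hy; rewrite -[y]opprK; apply: (gradingB gH) => //.
by rewrite -sub0r; apply: (gradingB gH) => //; apply: (grading0 gH).
Qed.

Lemma grading_disjoint i j x : i != j -> H i x -> H j x -> x = 0.
Proof.
move=> ij Hi Hj; pose y k := if k == i then x else if k == j then - x else 0.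
suff : y i = 0 by rewrite /y eqxx.
apply: (grading_free gH (s := [:: i; j])); rewrite ?inE ?eqxx //.
- by rewrite /= inE ij.
- move=> k; rewrite /y; case: eqP => [->//|_]; case: eqP => [->|_].
    by rewrite -sub0r; apply: (gradingB gH) => //; apply: (grading0 gH).
  exact: (grading0 gH).
by rewrite !big_cons big_nil /y eqxx eq_sym (negPf ij) eqxx addr0 subrr.
Qed.

(** Unlike in [grading_span], several terms may share a degree, so the [S j] need not be closed
    under addition. *)
Definition sum_of (S : int -> set M) (x : M) := exists s : seq (int * M),
  (forall p, p \in s -> S p.1 p.2) /\ x = \sum_(p <- s) p.2.

Lemma sum_of0 S : sum_of S 0.
Proof. by exists [::]; rewrite big_nil. Qed.

Lemma sum_ofD S x y : sum_of S x -> sum_of S y -> sum_of S (x + y).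
Proof.
move=> [s [Ss ->]] [t [St ->]]; exists (s ++ t); rewrite big_cat; split=> // p.
by rewrite mem_cat => /orP[/Ss|/St].
Qed.

Lemma sum_of_atom (S : int -> set M) j x : S j x -> sum_of S x.
Proof.
move=> Sx; exists [:: (j, x)]; rewrite big_seq1; split=> // p.
by rewrite inE => /eqP ->.
Qed.

Lemma sum_of_sum S (I : Type) (r : seq I) (F : I -> M) :
  (forall i, sum_of S (F i)) -> sum_of S (\sum_(i <- r) F i).
Proof.
by move=> SF; elim/big_ind: _ => //; [apply: sum_of0|apply: sum_ofD].
Qed.

(** The sum of the degrees is direct, so the terms of degree other than [j] cancel. *)
Lemma sum_of_homog (S : int -> set M) j x :
  (forall i, S i `<=` H i) -> sum_of S x -> H j x ->
  exists s : seq M, (forall y, y \in s -> S j y) /\ x = \sum_(y <- s) y.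
Proof.
move=> SH [s [Ss xs]] Hx; exists [seq p.2 | p <- s & p.1 == j]; split.
  move=> y /mapP[p]; rewrite mem_filter => /andP[/eqP <- ps] ->; exact: Ss.
rewrite big_map big_filter; apply/eqP; rewrite eq_sym -subr_eq0; apply/eqP.
pose y k := \sum_(p <- s | p.1 == k) p.2 - (if k == j then x else 0).
suff : y j = 0 by rewrite /y eqxx.
(* [j] is added because possibly no term of [s] has that degree. *)
pose r := undup (j :: [seq p.1 | p <- s]).
have jr : j \in r by rewrite mem_undup mem_head.
apply: (grading_free gH (s := r)) => //; first exact: undup_uniq.
  move=> k; apply: (gradingB gH); last first.
    by case: eqP => [->|_] //; apply: (grading0 gH).
  rewrite big_seq_cond; elim/big_ind: _ => //; first exact: (grading0 gH).
    by move=> *; apply: gradingD.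
  by move=> p /andP[ps /eqP <-]; apply/SH/Ss.
have single a (z : M) : a \in r -> \sum_(k <- r | k == a) z = z.
  by move=> ar; rewrite -big_filter filter_pred1_uniq ?undup_uniq ?big_seq1.
rewrite sumrB -big_mkcond /= single // (exchange_big_dep xpredT) //=.
apply/eqP; rewrite subr_eq0 [eqbRHS]xs; apply/eqP.
apply: eq_big_seq => p ps; under eq_bigl do rewrite eq_sym.
by apply: single; rewrite mem_undup inE map_f ?orbT.
Qed.

(** Additive generators of the degree [j] part of [A^+ M]. *)
Definition aug_homc (j : int) : set M := [set x | exists k a y,
  [/\ (0 < k)%N, a \is k.-homog, H (j - k.*2%:Z) y & x = a *: y]].

Lemma aug_homcW j : aug_homc j `<=` H j.
Proof.
move=> _ [k [a [y [_ ak Hy ->]]]].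
by have := gradingZ gH ak Hy; rewrite subrK.
Qed.

(** Split the coefficients into monomials, nonconstant because the constant coefficient vanishes,
    and the module elements into homogeneous components. *)
Lemma aug_sum_of x : x \in @aug K n M -> sum_of aug_homc x.
Proof.
case/augP => d [a [y [a0 ->]]]; apply: sum_of_sum => i.
rewrite (mpolyE (a i)) scaler_suml big_seq.
elim/big_ind: _ => [||m ma]; [exact: sum_of0|exact: sum_ofD|].
have [s [z [_ Hz ->]]] := grading_span gH (y i).
rewrite scaler_sumr; apply: sum_of_sum => j.
apply: (sum_of_atom (j := j + (mdeg m).*2%:Z)).
exists (mdeg m), ((a i)@_m *: 'X_[m]), (z j); rewrite addrK; split=> //.
  rewrite lt0n mdeg_eq0; apply: contraTneq ma => ->.
  by rewrite mcoeff_msupp a0 eqxx.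
by apply: rpredZ; rewrite dhomogX.
Qed.

(** A graded Nakayama argument, one degree at a time. *)
Lemma aug_eq0 j x : H j x -> x \in @aug K n M ->
  (forall k y, (0 < k)%N -> H (j - k.*2%:Z) y -> y = 0) -> x = 0.
Proof.
move=> Hx /aug_sum_of sx H0.
have [s [Ss ->]] := sum_of_homog aug_homcW sx Hx.
rewrite big_seq big1 // => y /Ss[k [a [z [k0 _ Hz ->]]]].
by rewrite (H0 k z) ?scaler0.
Qed.
End Gradings.

Lemma dhomog_mpolyC (K : nzRingType) n (c : K) : (c%:MP_[n]) \is 0.-homog.
Proof. by rewrite -[c%:MP]mulr1 mul_mpolyC; apply/rpredZ/dhomog1. Qed.

(** * Vanishing of stalks in negative and odd degrees *)

Section StalkDegrees.
Variables (R : realType) (V : vectType R).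

Lemma restr_surj (W U : {vspace V}) (q : {mpoly R[\dim U]}) :
  (U <= W)%VS -> exists p : {mpoly R[\dim W]}, restr U p = q.
Proof.
move=> UW.
(* [coordf j] is a linear form on all of [V]; [g j] is its restriction to [W], in the coordinates of
   [W]. *)
pose g (j : 'I_(\dim U)) : {mpoly R[\dim W]} :=
  \sum_(i < \dim W) coordf j (vbasis W)`_i *: 'X_i.
have gE j : restr U (g j) = 'X_j.
  rewrite /g linear_sum /=.
  under eq_bigr do rewrite linearZ /= restrX scaler_sumr.
  rewrite exchange_big /=.
  transitivity (\sum_(l < \dim U) (l == j)%:R *: 'X_l : {mpoly R[\dim U]}).
    apply: eq_bigr => l _; under eq_bigr do rewrite scalerA.
    rewrite -scaler_suml; congr (_ *: _).
    have uW : (vbasis U)`_l \in W.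
      by apply: (subvP UW); apply: vbasis_mem; rewrite mem_nth // size_tuple.
    rewrite -(coord_free l j (basis_free (vbasisP U))) {2}(coord_vbasis uW).
    by rewrite linear_sum; apply: eq_bigr => i _; rewrite linearZ mulrC.
  rewrite (bigD1 j) //= eqxx scale1r big1 ?addr0 // => l /negPf ->.
  exact: scale0r.
exists (q \mPo [tuple g j | j < \dim U]).
elim/mpolyind: q => [|c m p _ _ IH]; first by rewrite !raddf0.
rewrite !linearP /= IH comp_mpolyX rmorph_prod mpolyXE_id /=.
congr (_ *: _ + _).
by apply: eq_bigr => i _; rewrite rmorphXn tnth_mktuple /= gE.
Qed.

Definition vanishing_degree (j : int) := j < 0 \/ ~~ (2 %| j)%Z.

Lemma vanishing_degreeB j k :
  vanishing_degree j -> vanishing_degree (j - k.*2%:Z).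
Proof. by rewrite /vanishing_degree; lia. Qed.

Lemma graded_free_bounded_below n (M : gmod R n) : graded_free M ->
  exists N : int, forall j (x : M), j < N -> homc j x -> x = 0.
Proof.
move=> [d [b [k [bk bfree]]]].
(* This bounds every [k i] from below and also makes sense for [d = 0]. *)
exists (- \sum_(i < d) `|k i|%:Z) => j x jN Hx.
pose S j := [set y : M | exists i l p,
  [/\ p \is l.-homog, j = k i + l.*2%:Z & y = p *: b i]].
have SH i : S i `<=` homc i.
  by move=> _ [l [m [p [pm -> ->]]]]; apply: (gradingZ (homcP M)).
have sx : sum_of S x.
  have [c [-> _]] := bfree x; apply: sum_of_sum => i.
  rewrite (mpolyE (c i)) scaler_suml; apply: sum_of_sum => m.
  apply: (sum_of_atom (j := k i + (mdeg m).*2%:Z)).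
  exists i, (mdeg m), ((c i)@_m *: 'X_[m]); split=> //.
  by apply: rpredZ; rewrite dhomogX.
have [s [Ss ->]] := sum_of_homog (homcP M) SH sx Hx.
rewrite big_seq big1 // => y /Ss[i [l [p [_ jE _]]]].
have : `|k i|%:Z <= \sum_(i < d) `|k i|%:Z.
  by rewrite (bigD1 i) //= lerDl sumr_ge0.
by move: jN jE; lia.
Qed.

Variables (Phi : {fset (set V)}).

(** If the spans agreed, the form cutting out [tau] would vanish on [sigma]. This allows induction
    over cones by the dimension of the span. *)
Lemma dim_span_cone_lt (sigma tau : Phi) : fle tau sigma -> tau != sigma ->
  (\dim (span_cone tau) < \dim (span_cone sigma))%N.
Proof.
move=> le; apply: contraR; rewrite -leqNgt => led.
have /eqP E : span_cone tau == span_cone sigma by rewrite eqEdim span_coneS.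
have /asboolP[l [_ tauE]] := le.
apply/eqP/val_inj; rewrite tauE; apply/seteqP; split=> x; first by case.
move=> sx; split=> //=.
pose l' : {linear V -> R^o} := l.
have lK : forall y, val tau y -> y \in lker (linfun l').
  by move=> y; rewrite tauE memv_ker lfunE => -[_ /= ->].
have [_ least] := cspanP (val tau); have [incl _] := cspanP (val sigma).
have := subvP (least _ lK) x.
rewrite -[cspan _]/(span_cone tau) E => /(_ (incl _ sx)).
by rewrite memv_ker lfunE => /eqP.
Qed.

Variable L : sheaf Phi.

Lemma stalkA_grading sigma :
  @grading R _ (stalkA L sigma) (@homc _ _ (L sigma)).
Proof.
have G := homcP (L sigma); split.
- exact: (grading0 G).
- exact: (gradingB G).
- by move=> k j p x pk; apply: (gradingZ G); apply: restr_homog.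
- exact: (grading_span G).
- exact: (grading_free G).
Qed.

Lemma germ_homc tau j (x : stalkA L tau) :
  @homc _ _ (L tau) j x -> Gamma_homc j (germ x).
Proof. by move=> Hx i; apply: res_homc Hx; apply: bdryW. Qed.

Hypotheses (fanPhi : is_fan Phi) (minL : minimal_sheaf L).

Lemma germ_aug_inj (tau : Phi) (x : stalkA L tau) : val tau <> [set 0] ->
  germ x = 0 -> x \in @aug R _ (stalkA L tau).
Proof.
move=> /(minimal_bdry minL)/bij_inj inj gx; rewrite -[x]subr0; apply/to_barP.
by apply: inj; rewrite !bar_mapE /= gx linear0.
Qed.

Lemma germ_aug_surj (tau : Phi) (s : Gamma L (bdry tau)) :
  val tau <> [set 0] ->
  exists x : stalkA L tau, s - germ x \in @aug R _ (Gamma L (bdry tau)).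
Proof.
move=> /(minimal_bdry minL)[h _ hK]; exists (of_bar (h (to_bar s))).
by apply/to_barP; rewrite -{1}[to_bar s]hK -bar_mapE of_barK.
Qed.

Lemma stalk_vanishing (sigma : Phi) j (x : L sigma) :
  vanishing_degree j -> homc j x -> x = 0.
Proof.
elim/ltn_ind: {sigma}(\dim (span_cone sigma)) {-2}sigma
  (erefl (\dim (span_cone sigma))) j x.
move=> d IHd sigma dE j x vj Hx; subst d.
have [o0|no] := pselect (val sigma = [set 0]).
  have [e [He ex]] := minimal_origin minL o0.
  apply: (grading_disjoint (homcP (L sigma)) (i := j) (j := 0)) => //.
    by apply: contraPneq vj => ->; case.
  have [c [-> _]] := ex x.
  by have := gradingZ (homcP (L sigma)) (dhomog_mpolyC _ c) He; rewrite addr0.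
have inaug i (y : L sigma) : vanishing_degree i -> homc i y ->
    (y : stalkA L sigma) \in @aug R _ (stalkA L sigma).
  move=> vi Hy; apply: germ_aug_inj => //; apply: sec_inj; apply: prodP => tau.
  have lt : (\dim (span_cone (val tau)) < \dim (span_cone sigma))%N.
    by case: tau => tau /=; rewrite inE => /andP[]; apply: dim_span_cone_lt.
  by apply: (IHd _ lt _ erefl i) => //; apply: germ_homc Hy tau.
have [N Nlow] := graded_free_bounded_below (minimal_free minL sigma).
(* Induction on the degree, upwards from [N]: membership in [A^+] times the stalk reduces to
   strictly lower vanishing degrees. *)
suff above m : forall i (y : L sigma), i < N + m%:Z -> vanishing_degree i ->
    homc i y -> y = 0.
  by apply: (above `|j - N|.+1 j) => //; lia.
elim: m => [|m IHm] i y ilt vi Hy; first by apply: Nlow Hy; lia.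
apply: (aug_eq0 (stalkA_grading sigma) Hy (inaug _ _ vi Hy)) => k z k0 Hz.
by apply: IHm Hz; [lia|apply: vanishing_degreeB].
Qed.

Lemma Gamma_vanishing (U : {set Phi}) j (s : Gamma L U) :
  vanishing_degree j -> Gamma_homc j s -> s = 0.
Proof.
move=> vj Hs; apply: sec_inj; apply: prodP => i; apply: stalk_vanishing vj _.
exact: Hs.
Qed.

(** * Restriction to the origin in degree zero *)

Variable o : Phi.
Hypothesis o0 : val o = [set 0].

Lemma origin_le (sigma : Phi) : fle o sigma.
Proof. by apply/asboolP; rewrite o0; apply/(fan_vertex fanPhi)/valP. Qed.

Definition res_iso0 (sigma : Phi) :=
  (forall x : L sigma, homc 0 x -> res L sigma o x = 0 -> x = 0) /\
  (forall v : L o, homc 0 v ->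
     exists2 x : L sigma, homc 0 x & res L sigma o x = v).

Lemma Gamma_res_inj (U : {set Phi}) (s : Gamma L U) :
  (forall sigma, sigma \in U -> res_iso0 sigma) -> Gamma_homc 0 s ->
  (forall i, res L (val i) o (sec s i) = 0) -> s = 0.
Proof.
move=> isoU Hs s0; apply: sec_inj; apply: prodP => i.
by apply: (isoU (val i) (valP i)).1; [apply: Hs|apply: s0].
Qed.

(** Lifts of [v] chosen separately in the stalks are compatible, because restriction to [o] is
    injective in degree 0 on each stalk. *)
Lemma Gamma_res_surj (U : {set Phi}) (v : L o) :
  (forall sigma, sigma \in U -> res_iso0 sigma) -> homc 0 v ->
  exists2 s : Gamma L U, Gamma_homc 0 s &
    forall i, res L (val i) o (sec s i) = v.
Proof.
move=> isoU Hv.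
have lift (i : {x | x \in U}) :
    exists x : L (val i), homc 0 x /\ res L (val i) o x = v.
  by have [x] := (isoU (val i) (valP i)).2 v Hv; exists x.
pose s : prod_lmod (fun i : {x | x \in U} => stalkA L (val i)) :=
  fun i => projT1 (cid (lift i)).
have Hs i : @homc _ _ (L (val i)) 0 (s i) by have [] := projT2 (cid (lift i)).
have sv i : res L (val i) o (s i) = v by have [] := projT2 (cid (lift i)).
have cs : s \in @compatible _ _ _ L U.
  apply/asboolP => i k ki; apply/eqP; rewrite -subr_eq0; apply/eqP.
  apply: (isoU (val k) (valP k)).1.
    apply: (gradingB (homcP (L (val k)))) => //.
    exact: res_homc.
  by rewrite raddfB /= res_comp ?origin_le // !sv subrr.
by exists (Section_ cs).
Qed.

Lemma stalk_res_iso0 (sigma : Phi) : res_iso0 sigma.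
Proof.
elim/ltn_ind: {sigma}(\dim (span_cone sigma)) {-2}sigma
  (erefl (\dim (span_cone sigma))) => d IHd sigma dE; subst d.
have [s0|no] := pselect (val sigma = [set 0]).
  have -> : sigma = o by apply: val_inj; rewrite s0 o0.
  split=> [x _|v Hv]; first by rewrite res_id.
  by exists v; rewrite ?res_id.
have iso_bdry tau : tau \in bdry sigma -> res_iso0 tau.
  by rewrite inE => /andP[le ne]; apply: IHd erefl; apply: dim_span_cone_lt.
have ob : o \in bdry sigma.
  by rewrite inE origin_le; apply: contra_notN no => /eqP <-.
split=> [x Hx x0|v Hv].
  apply: (aug_eq0 (stalkA_grading sigma) Hx) => [|k y k0 Hy].
    apply: germ_aug_inj => //; apply: (Gamma_res_inj iso_bdry).
      exact: germ_homc.
    move=> i; rewrite -[sec _ _]/(res L sigma (val i) x).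
    by rewrite res_comp ?origin_le ?bdryW.
  by apply: stalk_vanishing Hy; left; lia.
have [s Hs sv] := Gamma_res_surj iso_bdry Hv.
have [x sx] := germ_aug_surj s no.
(* [x] need not be homogeneous. Decomposing [x] and [s - germ x] leaves in degree 0 only germs and
   multiples of sections of negative degree, which vanish. *)
pose S j := [set germ y | y in @homc _ _ (L sigma) j] `|`
  aug_homc (@Gamma_homc _ _ _ L (bdry sigma)) j.
have GH := Gamma_grading L (bdry sigma).
have SH j : S j `<=` Gamma_homc j.
  by move=> _ [[y Hy <-]|/(aug_homcW GH)//]; apply: germ_homc.
have sumS : sum_of S s.
  rewrite -[s](subrK (germ x)); apply: sum_ofD.
    have [r [Sr ->]] := aug_sum_of GH sx.
    by exists r; split=> // p /Sr; right.
  have [r [y [_ Hy ->]]] := grading_span (stalkA_grading sigma) x.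
  rewrite raddf_sum; apply: sum_of_sum => j; apply: (sum_of_atom (j := j)).
  by left; exists (y j).
have [r [Sr sE]] := sum_of_homog GH SH sumS Hs.
have [y Hy gy] :
    exists2 y : stalkA L sigma, @homc _ _ (L sigma) 0 y & germ y = s.
  rewrite sE big_seq.
  elim/big_ind: _ => [|_ _ [y Hy <-] [z Hz <-]|t /Sr[[y Hy <-]|]].
  - by exists 0; rewrite ?raddf0 //; apply: (grading0 (stalkA_grading sigma)).
  - exists (y + z); first exact: (gradingD (stalkA_grading sigma)).
    by rewrite raddfD.
  - by exists y.
  move=> [k [a [z [k0 _ Hz ->]]]]; exists 0.
    exact: (grading0 (stalkA_grading sigma)).
  rewrite (Gamma_vanishing _ Hz) ?scaler0 ?raddf0 //; left; lia.
by exists y => //; rewrite -(sv (exist _ o ob)) /= res_id -gy.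
Qed.
End StalkDegrees.

Lemma fan_origin (R : realType) (V : vectType R) (Phi : {fset (set V)}) :
  is_fan Phi -> exists o : Phi, val o = [set 0].
Proof.
move=> fanPhi; have [sigma sP] := fset0Pn _ (fan_neq0 fanPhi).
have oP := fan_face fanPhi sP (fan_vertex fanPhi sP).
by exists (FSetSub oP).
Qed.

(** * Finite generation of the module of sections *)

Section FiniteGeneration.
Variables (R : realType) (V : vectType R) (Phi : {fset (set V)}).
Variable L : sheaf Phi.
Hypothesis freeL : locally_free L.
Local Notation A := {mpoly R[\dim (fullv : {vspace V})]}.

(** The target, over [A], of the coefficient maps of a free stalk. *)
Definition coefA (sigma : Phi) : lmodType A :=
  res_scal (@restr R V fullv (span_cone sigma))
    ({mpoly R[\dim (span_cone sigma)]}^o : lmodType _).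

Lemma noetherian_coefA sigma : noetherian (coefA sigma).
Proof.
apply: noetherian_res_scal; last exact: noetherian_mpoly.
by move=> q; apply: restr_surj; apply: subvf.
Qed.

(** Coefficients on a basis embed the stalk in finitely many copies of [coefA sigma]; uniqueness
    makes them linear. *)
Lemma noetherian_stalkA (sigma : Phi) : noetherian (stalkA L sigma).
Proof.
have [d [b [_ [_ bfree]]]] := freeL sigma.
have [c cP] := choice bfree.
have cE x : x = \sum_(i < d) c x i *: b i by have [] := cP x.
have cU x (f : {ffun 'I_d -> _}) : x = \sum_(i < d) f i *: b i -> c x = f.
  by have [_] := cP x; apply.
pose g i (x : stalkA L sigma) : coefA sigma := c x i.
have glin i : linear (g i).
  move=> a x y; pose p := restr (span_cone sigma) a.
  have -> : a *: x + y = p *: (x : L sigma) + (y : L sigma) :> L sigma by [].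
  rewrite /g (cU _ [ffun i => p * c x i + c y i]) ?ffunE //.
  under eq_bigr do rewrite ffunE scalerDl -scalerA.
  by rewrite big_split -scaler_sumr -!cE.
pose G i : {linear stalkA L sigma -> coefA sigma} :=
  HB.pack (g i) (GRing.isLinear.Build _ _ _ _ (g i) (glin i)).
move=> P sP; apply: (fin_gen_jointly_injective (f := G) (r := enum 'I_d)) => //.
  by move=> _; apply: noetherian_coefA.
move=> x _ x0; rewrite [LHS]cE big1 // => i _.
by rewrite [c x i](x0 i) ?scale0r ?mem_enum.
Qed.

Lemma Gamma_fin_gen (U : {set Phi}) : fin_gen [set: Gamma L U].
Proof.
pose g (i : {x | x \in U}) (s : Gamma L U) : stalkA L (val i) := sec s i.
have glin i : linear (g i) by [].
pose G i : {linear Gamma L U -> stalkA L (val i)} :=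
  HB.pack (g i) (GRing.isLinear.Build _ _ _ _ (g i) (glin i)).
apply: (fin_gen_jointly_injective (f := G) (r := enum {: {x | x \in U}})) => //.
  by move=> i; apply: noetherian_stalkA.
move=> s _ s0; apply: sec_inj; apply: prodP => i.
by apply: s0; rewrite mem_enum.
Qed.
End FiniteGeneration.

Theorem lemma5p8 (R : realType) (V : vectType R) (Phi : {fset (set V)})
    (L : sheaf Phi) (fanPhi : is_fan Phi) (minL : minimal_sheaf L) :
  [/\ exists d : nat, has_dim [set: IH L] d,
      forall j : int, j < 0 \/ ~~ (2 %| j)%Z -> ih L j 0
    & ih L 0 1].
Proof.
split; first exact/has_dim_bar/Gamma_fin_gen/(minimal_free minL).
  move=> j vj; apply: has_dim0 => _ [s Hs <-].
  by rewrite (Gamma_vanishing minL vj Hs) raddf0.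
have [o o0] := fan_origin fanPhi.
have iso sigma : sigma \in [set: Phi]%SET -> res_iso0 L o sigma.
  by move=> _; apply: stalk_res_iso0.
have [e [He ex]] := minimal_origin minL o0.
have [s Hs se] := Gamma_res_surj fanPhi o0 iso He.
have GH := Gamma_grading L [set: Phi]%SET.
have sc c i : res L (val i) o (sec (c%:MP *: s) i) = c%:MP *: e.
  rewrite -[sec _ _]/(restr _ c%:MP *: (sec s i : L (val i))).
  by rewrite resZ ?origin_le // se /restr !comp_mpolyC.
have Hc c : Gamma_homc 0 (c%:MP *: s).
  by have := gradingZ GH (dhomog_mpolyC _ c) Hs; rewrite addr0.
exists (fun=> to_bar s); split=> [_|_ [t Ht <-]]; first by exists s.
have [c [tc _]] := ex (sec t (exist _ o (finset.in_setT o))).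
(* [A^+] times the global sections is zero in degree 0, so equal classes come from equal
   sections. *)
have cU c' : to_bar t = c' *: (to_bar s : IH L) -> t = c'%:MP *: s.
  rewrite -[_ *: _]to_barZ => /to_barP au.
  apply/eqP; rewrite -subr_eq0; apply/eqP.
  apply: (aug_eq0 GH _ au) => [|k y k0 Hy]; first exact: (gradingB GH).
  by apply: Gamma_vanishing Hy => //; left; lia.
(* Sections of degree 0 are determined by their value at [o]. *)
have tE : t = c%:MP *: s.
  apply/eqP; rewrite -subr_eq0; apply/eqP.
  apply: (Gamma_res_inj iso); first exact: (gradingB GH).
  move=> i; rewrite -[sec _ _]/((sec t i : L (val i)) - sec (c%:MP *: s) i).
  rewrite raddfB /= sc.
  rewrite (sec_compatible t (k := exist _ o (finset.in_setT o))) ?origin_le //.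
  by rewrite tc subrr.
exists [ffun=> c]; split.
  by rewrite big_ord1 ffunE tE; apply: (to_barZ (c : R)).
move=> f; rewrite big_ord1 => /cU; rewrite tE => cf.
apply/ffunP => i; rewrite ffunE (ord1 i).
(* Evaluation at [o] reduces uniqueness to that of the coefficient of [e]. *)
have [c' [_ c'U]] := ex (c%:MP *: e).
have /c'U <- : c%:MP *: e = c%:MP *: e by [].
by apply: c'U; rewrite -(sc c (exist _ o (finset.in_setT o))) cf sc.
Qed.
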